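(* Let $n\ge 5$ be an odd integer and let $k\ge 1$ be an integer. (1) If $k$ is odd and divisible by $n$, then the skewed $L$ $n$-omino is not replicating of order $k^2$. (2) If $k$ is even and not divisible by $n$, then the skewed $L$ $n$-omino is not replicating of order $k^2$.
   Context: Work in the square lattice; a cell is a unit square, identified with the integer coordinates $(\alpha,\beta)\in\mathbb{Z}^2$ of its lower left corner. $\mathcal{T}_n=\{T_1,T_2,T_3,T_4\}$ is the set of ribbon $L$-shaped $n$-ominoes, where, as sets of $n$ cells, $T_1=\{(0,j):0\le j\le n-2\}\cup\{(1,0)\}$, $T_2=\{(1,j):0\le j\le n-2\}\cup\{(0,n-2)\}$, $T_3=\{(i,0):0\le i\le n-2\}\cup\{(0,1)\}$, $T_4=\{(i,1):0\le i\le n-2\}\cup\{(n-2,0)\}$. Only translates of these tiles by integer vectors are allowed, and a region can be tiled by $\mathcal{T}_n$ if it is a disjoint union of such translates. The skewed $L$ $n$-omino is the image of the $L$ $n$-omino $T_1$ under a linear map that turns the square lattice into a lattice of skewed cells (rhombi). The four copies of the skewed tile obtained by the symmetries of the skewed lattice (identity, half-turn, reflections in the two diagonals of a skewed cell) correspond, when the lattice is straightened back to the square lattice, exactly to the four tiles of $\mathcal{T}_n$ up to translation. A tile is replicating of order $k^2$ if its $k$-inflated copy can be tiled by $k^2$ copies of the tile. For the skewed $L$ $n$-omino this means: the $k$-inflated copy of the (straight) $L$ $n$-omino $T_1$ can be tiled by $\mathcal{T}_n$ (ordinary tiling by translates). Here the $k$-inflated copy of a set of cells $P$ is $\{(k\alpha+i,k\beta+j):(\alpha,\beta)\in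 P,\ 0\le i,j\le k-1\}$. (By the symmetry of $\mathcal{T}_n$ under reflection in the line $y=x$, using $T_3$ in place of $T_1$ gives the same notion.) *)

(* Defs.v *)
From mathcomp Require Import all_boot all_order all_algebra.
From mathcomp Require Import boolp classical_sets.

Set Implicit Arguments.
Unset Strict Implicit.
Unset Printing Implicit Defensive.

Import Order.TTheory GRing.Theory Num.Theory.
Local Open Scope classical_set_scope.
Local Open Scope ring_scope.

(* A unit square of the lattice, named by its lower left corner. *)
Definition cell : Type := (int * int)%type.

(* The subtraction in [n%:Z - 2] takes place in [int], hence is not truncated. *)
Definition T1 (n : nat) : set cell :=
  [set c : cell | c.1 = 0 /\ 0 <= c.2 <= n%:Z - 2] `|` [set ((1, 0) : cell)].
Definition T2 (n : nat) : set cell :=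
  [set c : cell | c.1 = 1 /\ 0 <= c.2 <= n%:Z - 2] `|` [set ((0, n%:Z - 2) : cell)].
Definition T3 (n : nat) : set cell :=
  [set c : cell | c.2 = 0 /\ 0 <= c.1 <= n%:Z - 2] `|` [set ((0, 1) : cell)].
Definition T4 (n : nat) : set cell :=
  [set c : cell | c.2 = 1 /\ 0 <= c.1 <= n%:Z - 2] `|` [set ((n%:Z - 2, 0) : cell)].

Definition ribbonL (n : nat) : set (set cell) :=
  [set T | [\/ T = T1 n, T = T2 n, T = T3 n | T = T4 n]].

Definition translate (v : int * int) (A : set cell) : set cell :=
  [set ((v.1 + c.1, v.2 + c.2) : cell) | c in A].

(* Only translates are allowed: no rotation or reflection of a tile. *)
Definition can_be_tiled (TT : set (set cell)) (R : set cell) : Prop :=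
  exists P : set (set cell),
    (forall A, P A -> exists2 T, TT T & exists v, A = translate v T) /\
    partition P id R.

Definition inflate (k : nat) (A : set cell) : set cell :=
  [set c | exists2 a : cell, A a & exists i j : nat,
     [/\ (i < k)%N, (j < k)%N & c = (k%:Z * a.1 + i%:Z, k%:Z * a.2 + j%:Z)]].

(* The skewed L n-omino is replicating of order k^2. The skewed lattice is
   straightened to the square lattice, where the skewed tile becomes [T1 n] and
   its four copies under the symmetries of the skewed lattice become, up to
   translation, the members of [ribbonL n]. A tiling of the inflated copy has
   k^2 tiles, since [T1 n] and all the tiles have n cells. *)
Definition skewedL_replicating (n k : nat) : Prop :=
  can_be_tiled (ribbonL n) (inflate k (T1 n)).

(* Main.v *)
(** The inflated copy is a Young diagram (with decreasing column heights) and
    every tile is a ribbon running from north-west to south-east, so a tiling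
    can be dismantled by removing one rim hook of size n at a time. Encode the
    diagram by its beads (beta-numbers: column height plus
    reversed column index): removing a rim hook moves a bead from p to p - n.
    Let Phi be the number of pairs of beads (x, y) with y < x and
    y = x + 1 modulo n. The move changes Phi by the number of beads at p - 1
    minus the number of beads at p - n + 1, and for each of the four L-shaped
    tiles exactly one of these two positions is occupied. Hence the number k^2
    of tiles has the parity of the difference of Phi between the inflated copy
    and the empty diagram, and for odd n this difference is odd exactly when n
    does not divide k. So a tiling forces k to be odd if and only if n does not
    divide k. *)

Require Import Defs.
From mathcomp Require Import all_boot all_order all_algebra.
From mathcomp Require Import classical_sets zify.

Set Implicit Arguments.
Unset Strict Implicit.
Unset Printing Implicit Defensive.

Import Order.TTheory GRing.Theory Num.Theory.

(** * Ribbons and walking along them *)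

(* Column [rcol R + i], for [i < rwidth R], consists of the cells of height at
   least [rtop R i.+1 - 1] and less than [rtop R i]: consecutive columns overlap
   in exactly one row. The extra value [rtop R (rwidth R)] only fixes the bottom
   of the last column. *)
Record ribbon := Ribbon { rcol : nat; rwidth : nat; rtop : nat -> nat }.

Definition ribbon_wf (R : ribbon) : Prop :=
  [/\ 0 < rwidth R, 0 < rtop R (rwidth R) &
      forall i, i < rwidth R -> rtop R i.+1 <= rtop R i].

Definition in_ribbon (R : ribbon) (x y : nat) : bool :=
  [&& rcol R <= x, x < rcol R + rwidth R,
      rtop R (x - rcol R).+1 <= y.+1 & y.+1 <= rtop R (x - rcol R)].

Lemma rtop_le (R : ribbon) (i j : nat) :
  ribbon_wf R -> i <= j -> j <= rwidth R -> rtop R j <= rtop R i.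
Proof.
case=> _ _ mono; elim: j => [|j IH] leij lejw; first by have -> : i = 0 by lia.
have [->//|neij] := eqVneq i j.+1.
by apply: leq_trans (mono _ lejw) (IH _ _); lia.
Qed.

Lemma in_ribbon_top (R : ribbon) (i : nat) :
  ribbon_wf R -> i < rwidth R -> in_ribbon R (rcol R + i) (rtop R i).-1.
Proof.
move=> wfR ltiw; have [_ gt0 mono] := wfR.
have ge := @rtop_le R i.+1 (rwidth R) wfR ltiw (leqnn _).
have := mono i ltiw; rewrite /in_ribbon addKn; lia.
Qed.

(** A walk along [R] to the south-east goes down while the column has a lower cell, and otherwise
    right, since the next column has its top in this very row; both fail only at the final cell. *)
Lemma in_ribbon_next (R : ribbon) (x y : nat) :
  ribbon_wf R -> in_ribbon R x y ->
  [\/ x.+1 = rcol R + rwidth R /\ y.+1 = rtop R (rwidth R),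
      in_ribbon R x.+1 y | 0 < y /\ in_ribbon R x y.-1].
Proof.
move=> wfR /and4P[ax xw lo hi]; have [_ gt0 mono] := wfR.
have gti : 0 < rtop R (x - rcol R).+1.
  by apply: leq_trans gt0 (rtop_le wfR _ _); lia.
have [lty|] := ltnP (rtop R (x - rcol R).+1) y.+1.
  by constructor 3; split; [lia|rewrite /in_ribbon; lia].
move=> gey; have [ltw|gew] := ltnP x.+1 (rcol R + rwidth R).
  constructor 2; rewrite /in_ribbon (leqW ax) ltw subSn //.
  have := mono (x - rcol R).+1; lia.
have eqw : (x - rcol R).+1 = rwidth R by lia.
by constructor 1; rewrite -{2}eqw; lia.
Qed.

(** * Young diagrams, ribbon tilings and removable ribbons *)

Definition young (h : nat -> nat) : Prop := forall i, h i.+1 <= h i.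

Lemma young_le (h : nat -> nat) (i j : nat) : young h -> i <= j -> h j <= h i.
Proof.
move=> yh; elim: j => [|j IH] leij; first by have -> : i = 0 by lia.
have [->//|neij] := eqVneq i j.+1.
by apply: leq_trans (yh j) (IH _); lia.
Qed.

(** Disjointness is phrased through equality of cells, not of records: [rtop] is arbitrary beyond
    [rwidth R], so different records may describe one ribbon. *)
Definition ribbon_tiling (h : nat -> nat) (Q : ribbon -> Prop) : Prop :=
  [/\ forall R, Q R -> ribbon_wf R,
      forall R x y, Q R -> in_ribbon R x y -> y < h x,
      forall x y, y < h x -> exists2 R, Q R & in_ribbon R x y &
      forall R S x y, Q R -> Q S -> in_ribbon R x y -> in_ribbon S x y ->
        in_ribbon R =2 in_ribbon S].

(** The ribbon forms the top of each of its columns, and the row of its final cell is vacant in the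
    next column; so the heights stay nonincreasing after removal. *)
Definition removable (h : nat -> nat) (R : ribbon) : Prop :=
  (forall i, i < rwidth R -> h (rcol R + i) = rtop R i) /\
  h (rcol R + rwidth R) < rtop R (rwidth R).

(* If [R] is blocked, the cell on top of the rightmost column of [R] that is
   not exposed is the last cell of another ribbon, further to the north-west. *)
Lemma removable_step (h : nat -> nat) (Q : ribbon -> Prop) (R : ribbon) :
  young h -> ribbon_tiling h Q -> Q R ->
  h (rcol R + rwidth R) < rtop R (rwidth R) ->
  exists2 S, Q S & removable h S.
Proof.
move=> yh [Qwf Qin Qcov Qdis].
(* The search moves to a ribbon whose final cell is strictly higher and not further right, so this
   measure drops; [h 0] bounds all heights. *)
have [m] := ubnP (rcol R + rwidth R + (h 0 - rtop R (rwidth R))).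
elim: m R => // m IH R ltm QR last.
have wfR := Qwf R QR; have [w0 gt0 mono] := wfR.
have ge i : i < rwidth R -> rtop R i <= h (rcol R + i).
  move=> ltiw; have := Qin R _ _ QR (in_ribbon_top wfR ltiw); lia.
have [/forallP eqR|/forallPn[i0 nei0]] :=
  boolP [forall i : 'I_(rwidth R), h (rcol R + i) == rtop R i].
  exists R => //; split=> // i ltiw; exact: (eqP (eqR (Ordinal ltiw))).
have [|i|i /andP[ltiw nei] maxi] :=
  @ex_maxnP (fun i => (i < rwidth R) && (h (rcol R + i) != rtop R i))
    (rwidth R).
- by exists i0; rewrite ltn_ord.
- by case/andP=> /ltnW.
(* Later columns of [R] are exposed by maximality of [i], and [last] bounds the column after [R]; so
   the cell above [R] in column [i] has no right neighbour in the diagram. *)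
have right : h (rcol R + i).+1 <= rtop R i.
  have [ltSi|geSi] := ltnP i.+1 (rwidth R); last first.
    have eqw : i.+1 = rwidth R by lia.
    move: last; rewrite -eqw addnS; have := mono i ltiw; lia.
  have [->|ne] := eqVneq (h (rcol R + i).+1) (rtop R i.+1); first exact: mono.
  by have := maxi i.+1; rewrite ltSi addnS ne => /(_ isT); lia.
have up : rtop R i < h (rcol R + i) by have := ge i ltiw; lia.
have [S QS inS] := Qcov _ _ up.
have wfS := Qwf S QS.
case: (in_ribbon_next wfS inS) => [[eqx eqy]|inS'|[gty inS']].
- apply: (IH S) => //.
    rewrite -eqx -eqy.
    have := @rtop_le R i (rwidth R) wfR (ltnW ltiw) (leqnn _).
    have := young_le yh (leq0n (rcol R + i)); lia.
  by rewrite -eqx -eqy; lia.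
- by have := Qin _ _ _ QS inS'; lia.
(* The cell below is the top of [R] in this column, so [S] would coincide with [R], yet it contains
   a cell above [R]. *)
- have := Qdis _ _ _ _ QS QR inS' (in_ribbon_top wfR ltiw).
  by move=> /(_ (rcol R + i) (rtop R i)); rewrite inS /in_ribbon addKn ltnn !andbF.
Qed.

(** The bottom cell of the last nonempty column has no cell of the diagram to its right or below, so
    it is the final cell of its ribbon, and the search can start there. *)
Lemma exists_removable (h : nat -> nat) (M : nat) (Q : ribbon -> Prop) :
  young h -> h M = 0 -> 0 < h 0 -> ribbon_tiling h Q ->
  exists2 R, Q R & removable h R.
Proof.
move=> yh hM h0 tQ; have [Qwf Qin Qcov _] := tQ.
have [|x|x hx maxx] := @ex_maxnP (fun x => 0 < h x) M; first by exists 0.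
  move=> hx; rewrite leqNgt; apply/negP=> ltMx.
  by have := young_le yh (ltnW ltMx); lia.
have hS : h x.+1 = 0.
  by apply/eqP; rewrite -leqn0 leqNgt; apply/negP=> /maxx; lia.
have [R QR inR] := Qcov _ _ hx.
case: (in_ribbon_next (Qwf R QR) inR) => [[eqx eqy]|inR'|[]//].
  by apply: (removable_step yh tQ QR); rewrite -eqx -eqy hS.
by have := Qin _ _ _ QR inR'; rewrite hS.
Qed.

(** * Removing a ribbon from the diagram *)

Definition peel (h : nat -> nat) (R : ribbon) (i : nat) : nat :=
  if rcol R <= i < rcol R + rwidth R then (rtop R (i - rcol R).+1).-1 else h i.

Lemma young_peel (h : nat -> nat) (R : ribbon) :
  young h -> ribbon_wf R -> removable h R -> young (peel h R).
Proof.
move=> yh wfR [eqh last] i; have [w0 gt0 mono] := wfR.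
rewrite /peel; case: ifP => [/andP[lo hi]|out]; case: ifP => [/andP[lo' hi']|out'].
- by rewrite subSn //; have := mono (i - rcol R).+1; lia.
- have -> : i.+1 - rcol R = 0 by lia.
  have := yh i; have := eqh 0 w0; have := mono 0 w0.
  have -> : rcol R + 0 = i.+1 by lia.
  by lia.
- have -> : i.+1 = rcol R + rwidth R by lia.
  have -> : (i - rcol R).+1 = rwidth R by lia.
  by move: last; lia.
- exact: yh.
Qed.

Lemma ltn_peel (h : nat -> nat) (R : ribbon) (x y : nat) :
  ribbon_wf R -> removable h R ->
  (y < peel h R x) = (y < h x) && ~~ in_ribbon R x y.
Proof.
move=> [w0 gt0 mono] [eqh _]; rewrite /peel /in_ribbon.
have [/andP[lo hi]|out] := boolP (rcol R <= x < rcol R + rwidth R).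
  have := mono (x - rcol R); have := eqh (x - rcol R); rewrite subnKC //; lia.
by lia.
Qed.

Lemma ribbon_tiling_peel (h : nat -> nat) (Q : ribbon -> Prop) (R : ribbon) :
  ribbon_tiling h Q -> Q R -> removable h R ->
  ribbon_tiling (peel h R) (fun S => Q S /\ ~ in_ribbon S =2 in_ribbon R).
Proof.
move=> [Qwf Qin Qcov Qdis] QR remR; have wfR := Qwf R QR.
split=> [S [/Qwf]//|S x y [QS neS] inS|x y|S T x y [QS _] [QT _]].
- rewrite ltn_peel // (Qin S) //=; apply/negP=> inR.
  exact/neS/(Qdis _ _ _ _ QS QR inS inR).
- rewrite ltn_peel // => /andP[ltyh ninR].
  have [S QS inS] := Qcov _ _ ltyh; exists S => //; split=> // eqS.
  by rewrite -eqS inS in ninR.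
- exact: Qdis.
Qed.

(** * Beads before and after a removal *)

Definition beads (M : nat) (h : nat -> nat) : seq nat :=
  [seq h i + (M - i) | i <- iota 0 M].

Definition inner_beads (M : nat) (R : ribbon) : seq nat :=
  [seq rtop R i + (M - (rcol R + i)) | i <- iota 1 (rwidth R).-1].

Definition outer_beads (M : nat) (h : nat -> nat) (R : ribbon) : seq nat :=
  [seq h i + (M - i) | i <- iota 0 (rcol R) ++
     iota (rcol R + rwidth R) (M - (rcol R + rwidth R))].

Definition top_bead (M : nat) (R : ribbon) : nat := rtop R 0 + (M - rcol R).

Definition bottom_bead (M : nat) (R : ribbon) : nat :=
  rtop R (rwidth R) + (M - (rcol R + rwidth R)).

Lemma iota_split (a w M : nat) : a + w <= M ->
  iota 0 M = iota 0 a ++ map (addn a) (iota 0 w) ++ iota (a + w) (M - (a + w)).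
Proof.
move=> le; rewrite -{1}(subnKC le) iotaD iotaD -catA add0n.
by rewrite -iotaDl addn0.
Qed.

Lemma perm_beads (M : nat) (h : nat -> nat) (R : ribbon) :
  ribbon_wf R -> removable h R -> rcol R + rwidth R <= M ->
  perm_eq (beads M h) (top_bead M R :: inner_beads M R ++ outer_beads M h R).
Proof.
move=> [w0 _ _] [eqh _] le.
rewrite /beads (iota_split le) /outer_beads !map_cat perm_sym.
rewrite -cat_cons perm_catCA perm_cat2l perm_cat2r -map_comp.
have -> : [seq ((fun i => h i + (M - i)) \o addn (rcol R)) i
             | i <- iota 0 (rwidth R)]
        = [seq rtop R i + (M - (rcol R + i)) | i <- iota 0 (rwidth R)].
  by apply/eq_in_map=> i; rewrite mem_iota => /andP[_ ltiw] /=; rewrite eqh.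
by rewrite /inner_beads /top_bead; case: (rwidth R) w0 => //= w _; rewrite addn0.
Qed.

(** Column [i] of [R] drops to height [rtop R i.+1 - 1]; the lost unit is offset by the index shift,
    so it takes over the old bead of column [i.+1]. Only the top bead disappears, and the last
    column yields the bottom bead. *)
Lemma perm_beads_peel (M : nat) (h : nat -> nat) (R : ribbon) :
  ribbon_wf R -> removable h R -> rcol R + rwidth R <= M ->
  perm_eq (beads M (peel h R))
          (bottom_bead M R :: inner_beads M R ++ outer_beads M h R).
Proof.
move=> wfR _ le; have [w0 gt0 _] := wfR.
rewrite /beads (iota_split le) /outer_beads !map_cat perm_sym.
rewrite -cat_cons perm_catCA.
have -> : [seq peel h R i + (M - i) | i <- iota 0 (rcol R)]
        = [seq h i + (M - i) | i <- iota 0 (rcol R)].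
  by apply/eq_in_map=> i; rewrite mem_iota /peel => ?; case: ifP => //; lia.
rewrite perm_cat2l.
have -> : [seq peel h R i + (M - i)
             | i <- iota (rcol R + rwidth R) (M - (rcol R + rwidth R))]
        = [seq h i + (M - i)
             | i <- iota (rcol R + rwidth R) (M - (rcol R + rwidth R))].
  by apply/eq_in_map=> i; rewrite mem_iota /peel => ?; case: ifP => //; lia.
rewrite perm_cat2r -map_comp.
have -> : [seq ((fun i => peel h R i + (M - i)) \o addn (rcol R)) i
             | i <- iota 0 (rwidth R)]
        = rcons (inner_beads M R) (bottom_bead M R).
  rewrite /inner_beads /bottom_bead.
  rewrite -(map_rcons (fun i => rtop R i + (M - (rcol R + i)))).
  have -> : rcons (iota 1 (rwidth R).-1) (rwidth R) = map succn (iota 0 (rwidth R)).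
    case: (rwidth R) w0 => // w _.
    have -> : map succn (iota 0 w.+1) = iota 1 w.+1 by exact: esym (iotaDl 1 0 _).
    by rewrite -(addn1 w) iotaD cats1 addn1 add1n.
  rewrite -map_comp; apply/eq_in_map => i; rewrite mem_iota => /andP[_ ltiw] /=.
  have := @rtop_le R i.+1 (rwidth R) wfR ltiw (leqnn _).
  by rewrite /peel addKn; case: ifP; lia.
by rewrite perm_sym perm_rcons.
Qed.

(** * Crossings and the effect of moving one bead *)

Definition crosses (n x y : nat) : bool := (y < x) && (y == x.+1 %[mod n]).

Definition crossings (n : nat) (s : seq nat) : nat :=
  \sum_(x <- s) \sum_(y <- s) crosses n x y.

Lemma perm_crossings (n : nat) (s t : seq nat) :
  perm_eq s t -> crossings n s = crossings n t.
Proof.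
move=> st; rewrite /crossings (perm_big _ st).
by apply: eq_bigr => x _; rewrite (perm_big _ st).
Qed.

Lemma eqn_mod_window (n q t : nat) : 1 < n -> t <= n ->
  (q + t == q.+1 %[mod n]) = (t == 1).
Proof.
move=> n1 ltn; rewrite -addn1 eqn_modDl (modn_small n1).
have [->|ne] := eqVneq t n; first by rewrite modnn; lia.
by rewrite modn_small //; lia.
Qed.

(** The residue is unchanged, so only [y] from [q] to [q + n - 1] is affected, and [q.+1] is the one
    position there in the right class. *)
Lemma crosses_move_l (n q y : nat) : 1 < n ->
  (crosses n (q + n) y : nat) = crosses n q y + (y == q.+1).
Proof.
move=> n1; rewrite /crosses -addSn modnDr.
have [ltyq|leqy] := ltnP y q; first by have -> : (y < q + n); lia.
rewrite andFb add0n -(subnKC leqy).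
have [ltyn|leny] := ltnP (q + (y - q)) (q + n); last by lia.
by rewrite eqn_mod_window //; lia.
Qed.

Lemma crosses_move_r (n x q : nat) : 1 < n ->
  (crosses n x q : nat) = crosses n x (q + n) + (x == (q + n).-1).
Proof.
move=> n1; rewrite /crosses modnDr.
have [ltpx|lexp] := ltnP (q + n) x; first by have -> : (q < x); lia.
rewrite andFb add0n; have [ltqx|lexq] := ltnP q x; last by lia.
rewrite -(subnKC (ltnW (leqW ltqx))) -{1}[q]addn0 eqn_modDl mod0n.
have [->|neS] := eqVneq x (q + n).
  rewrite -addnS addKn -addn1 modnDl modn_small //; lia.
have [eqn|ne] := eqVneq (x.+1 - q) n; first by rewrite eqn modnn; lia.
rewrite modn_small; lia.
Qed.

Lemma crossings_cons (n p : nat) (r : seq nat) :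
  crossings n (p :: r) =
  \sum_(y <- r) crosses n p y + \sum_(x <- r) crosses n x p + crossings n r.
Proof.
rewrite /crossings !big_cons /crosses ltnn add0n -addnA; congr (_ + _).
by rewrite -big_split; apply: eq_bigr => x _; rewrite big_cons.
Qed.

Lemma sum_eq_count (a : nat) (r : seq nat) :
  \sum_(x <- r) (x == a) = count_mem a r.
Proof. by rewrite -sum1_count [RHS]big_mkcond. Qed.

(** Moving down to [q], the bead loses its crossings with beads at [q.+1] below it and gains those
    with beads at [(q + n).-1] above it. Counts on both sides avoid truncated subtraction. *)
Lemma crossings_move (n q : nat) (r : seq nat) : 1 < n ->
  crossings n (q + n :: r) + count_mem (q + n).-1 r =
  crossings n (q :: r) + count_mem q.+1 r.
Proof.
move=> n1; rewrite !crossings_cons -!sum_eq_count.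
rewrite (eq_bigr _ (fun y _ => crosses_move_l q y n1)).
rewrite [in RHS](eq_bigr _ (fun x _ => crosses_move_r x q n1)) !big_split /=.
lia.
Qed.

(** * L-shaped ribbons flip the parity *)

Ltac split_ifs :=
  repeat match goal with
  | |- context [if ?c then _ else _] => let H := fresh "H" in destruct c eqn:H
  end.

(* Up to translation, [w = 2] gives [T1] (not late) and [T2] (late), while
   [w = n - 1] gives [T3] (not late) and [T4] (late): the height drops by [n - w]
   right after the first column or right after the last one. *)
Definition Lribbon (n w : nat) (late : bool) (a b : nat) : ribbon :=
  Ribbon a w (fun i =>
    b.+1 + (if i < (if late then w else 1) then n - w else 0)).

Lemma Lribbon_wf n w late a b : 0 < w -> ribbon_wf (Lribbon n w late a b).
Proof.
move=> w0; split=> //= i iw.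
by case: late; split_ifs; lia.
Qed.

Definition Lribbons (n : nat) (R : ribbon) : Prop :=
  exists w late a b, 1 < w < n /\ R = Lribbon n w late a b.

Lemma crossings_peel (n M : nat) (h : nat -> nat) (R : ribbon) :
  1 < n -> young h -> Lribbons n R -> removable h R ->
  rcol R + rwidth R <= M ->
  odd (crossings n (beads M h)) = ~~ odd (crossings n (beads M (peel h R))).
Proof.
move=> n1 yh [w [late [a [b [/andP[w1 wn] defR]]]]] remR leM.
have wfR : ribbon_wf R by rewrite defR; apply: Lribbon_wf; lia.
rewrite (perm_crossings n (perm_beads wfR remR leM)).
rewrite (perm_crossings n (perm_beads_peel wfR remR leM)).
have topE : top_bead M R = bottom_bead M R + n.
  by move: leM; rewrite /top_bead /bottom_bead defR /=; case: (late); split_ifs; lia.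
have := crossings_move (bottom_bead M R) (inner_beads M R ++ outer_beads M h R) n1.
rewrite -topE !count_cat.
(* Columns left of [R] are at least as high as its first one, so their beads exceed the top bead;
   columns right of [R] have beads below the bottom bead. *)
have out0 c : bottom_bead M R <= c <= top_bead M R ->
    count_mem c (outer_beads M h R) = 0.
  move=> /andP[lo hi]; apply/count_memPn/mapP=> -[i].
  have [eqh last] := remR; have [w0 _ _] := wfR.
  rewrite mem_cat !mem_iota => /orP[] /andP[lei lti] eqc.
    rewrite add0n in lti; have := young_le yh (ltnW lti); have := eqh 0 w0; rewrite addn0.
    by move: eqc hi; rewrite /top_bead; lia.
  by have := young_le yh lei; move: eqc lo; rewrite /bottom_bead; lia.
rewrite !out0; [|lia|lia].
have inner1 : count_mem (top_bead M R).-1 (inner_beads M R) +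
              count_mem (bottom_bead M R).+1 (inner_beads M R) = 1.
  have uniq_inner : uniq (inner_beads M R).
    rewrite map_inj_in_uniq ?iota_uniq // => i j.
    rewrite !mem_iota => /andP[i1 iw] /andP[j1 jw].
    by move: leM iw jw; rewrite defR /=; case: (late); split_ifs; lia.
  rewrite !count_uniq_mem //; case: late defR => defR.
    have -> : (top_bead M R).-1 \in inner_beads M R.
      (* In the late case [rtop] agrees at 0 and 1, so column 1 gives the bead just below the top
         one. *)
      apply/mapP; exists 1; first by rewrite mem_iota defR /=; lia.
      by move: leM; rewrite /top_bead defR /=; split_ifs; lia.
    have -> : (bottom_bead M R).+1 \in inner_beads M R = false.
      apply/negP=> /mapP[i]; rewrite mem_iota => /andP[i1 iw].
      by move: leM iw; rewrite /bottom_bead defR /=; split_ifs; lia.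
    by [].
  have -> : (top_bead M R).-1 \in inner_beads M R = false.
    apply/negP=> /mapP[i]; rewrite mem_iota => /andP[i1 iw].
    by move: leM iw; rewrite /top_bead defR /=; split_ifs; lia.
  have -> // : (bottom_bead M R).+1 \in inner_beads M R.
  (* In the early case [rtop] agrees at [w.-1] and [w], so the last column gives the bead just above
     the bottom one. *)
  apply/mapP; exists w.-1; first by rewrite mem_iota defR /=; lia.
  by move: leM; rewrite /bottom_bead defR /=; split_ifs; lia.
by lia.
Qed.

(** Here [t] counts the removals. The bead sum falls by [n] at each, so it determines [t] without
    any cardinality of [Q]; it also drives the induction. *)
Lemma tiling_parity (n M : nat) (h : nat -> nat) (Q : ribbon -> Prop) :
  young h -> h M = 0 -> ribbon_tiling h Q -> (forall R, Q R -> Lribbons n R) ->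
  exists2 t, sumn (beads M h) = n * t + sumn (beads M (fun=> 0)) &
    odd (crossings n (beads M h)) =
    odd t (+) odd (crossings n (beads M (fun=> 0))).
Proof.
have [m] := ubnP (sumn (beads M h)); elim: m h Q => // m IH h Q ltm yh hM tQ LQ.
have [h0|h0] := posnP (h 0).
  exists 0; rewrite ?muln0 ?add0n ?addFb.
    by congr sumn; apply/eq_map=> i; have := young_le yh (leq0n i); lia.
  by congr (odd (crossings n _)); apply/eq_map=> i; have := young_le yh (leq0n i); lia.
have [R QR remR] := exists_removable yh hM h0 tQ.
have [Qwf Qin _ _] := tQ; have wfR := Qwf R QR; have [w0 _ _] := wfR.
have leM : rcol R + rwidth R <= M.
  have ltw : (rwidth R).-1 < rwidth R by lia.
  have := Qin R _ _ QR (in_ribbon_top wfR ltw); rewrite leqNgt => pos.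
  apply/negP=> ltM; have le : M <= rcol R + (rwidth R).-1 by lia.
  have := young_le yh le; lia.
have n1 : 1 < n by have [w [l [a [b [/andP[]]]]]] := LQ R QR; lia.
have area : sumn (beads M h) = n + sumn (beads M (peel h R)).
  rewrite (perm_sumn (perm_beads wfR remR leM)).
  rewrite (perm_sumn (perm_beads_peel wfR remR leM)) /= addnA; congr (_ + _).
  rewrite /top_bead /bottom_bead.
  have [w [l [a [b [/andP[w1 wn] defR]]]]] := LQ R QR.
  by move: leM; rewrite defR /=; case: (l); split_ifs; lia.
have ltm' : sumn (beads M (peel h R)) < m by lia.
have hM' : peel h R M = 0 by rewrite /peel hM; case: ifP => //; lia.
have [S []|t areat oddt] := IH _ _ ltm' (young_peel yh wfR remR) hM'
  (ribbon_tiling_peel tQ QR remR).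
  by move=> /LQ.
exists t.+1; first by rewrite area areat mulnS addnA.
by rewrite (crossings_peel n1 yh (LQ R QR) remR leM) oddt /= addNb.
Qed.

(** * Blocks of consecutive beads *)

Lemma crossings_cat (n : nat) (s t : seq nat) :
  crossings n (s ++ t) = crossings n s + crossings n t +
    \sum_(x <- s) \sum_(y <- t) crosses n x y +
    \sum_(x <- t) \sum_(y <- s) crosses n x y.
Proof.
rewrite /crossings big_cat /=.
under eq_bigr do rewrite big_cat /=.
under [X in _ + X = _]eq_bigr do rewrite big_cat /=.
by rewrite !big_split /=; lia.
Qed.

Definition block (c k : nat) : seq nat := [seq c + i.+1 | i <- iota 0 k].

Lemma crossings_block (n c k : nat) : crossings n (block c k) = crossings n (block 0 k).
Proof.
rewrite /crossings !big_map; apply: eq_bigr => i _; rewrite !big_map.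
apply: eq_bigr => j _; rewrite /crosses ltn_add2l add0n -addnS eqn_modDl.
by [].
Qed.

Lemma perm_block (f : nat -> nat) (c k : nat) :
  (forall i, i < k -> f i = c + (k - i)) ->
  perm_eq [seq f i | i <- iota 0 k] (block c k).
Proof.
move=> fE; have -> : map f (iota 0 k) = [seq c + (k - i) | i <- iota 0 k].
  by apply/eq_in_map=> i; rewrite mem_iota => /fE.
apply: uniq_perm; try (rewrite map_inj_in_uniq ?iota_uniq // => i j;
  rewrite !mem_iota; lia).
move=> x; apply/mapP/mapP=> -[i]; rewrite mem_iota => lti ->;
  by exists (k - i.+1); rewrite ?mem_iota; lia.
Qed.

(** * Counting pairs by their difference modulo n *)

Definition residues (n k c : nat) : nat := \sum_(0 <= i < k) (i == c %[mod n]).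

(** Each of [q] full periods meets every class once, and the rest covers the classes below [r].
    Allowing [r = n] lets a completed period close the induction on [q]. *)
Lemma residuesE (n q r c : nat) : 0 < n -> r <= n ->
  residues n (q * n + r) c = q + (c %% n < r).
Proof.
move=> n0; elim: q r => [|q IHq].
  elim=> [|r IHr] ler; first by rewrite /residues big_nil.
  rewrite mul0n !add0n /residues big_nat_recr //= -/(residues n r c).
  have := IHr (ltnW ler); rewrite mul0n !add0n => ->.
  by rewrite (modn_small ler); lia.
elim=> [|r IHr] ler.
  by rewrite addn0 mulSnr IHq // ltn_pmod //; lia.
rewrite addnS /residues big_nat_recr //= -/(residues n _ c) (IHr (ltnW ler)).
by rewrite modnMDl (modn_small ler); lia.
Qed.

(** The number of pairs [(i, j)] below [k] with [i - j] congruent to [c] modulo [n]. *)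
Definition diffs (n k c : nat) : nat :=
  \sum_(0 <= j < k) residues n k (c + j).

Lemma diffsS (n k c : nat) :
  diffs n k c.+1 + residues n k c = diffs n k c + residues n k (c + k).
Proof.
rewrite /diffs -big_nat_recr //= big_nat_recl //= addn0 addnC; congr (_ + _).
by apply: eq_bigr => i _; rewrite addSnnS.
Qed.

(** Two uses of [diffsS] reduce the parity to residue counts at [k.-1], [k], [k.-1 + k] and [k + k].
    All four agree when [n] divides [k]; otherwise the first two differ by one and the last two
    agree. *)
Lemma odd_diffs (n k : nat) : 1 < n -> odd n -> 0 < k ->
  odd (diffs n k k.-1) (+) odd (diffs n k k.+1) = ~~ (n %| k).
Proof.
move=> n1 nodd k0.
have := diffsS n k k; have := diffsS n k k.-1; rewrite prednK //.
rewrite /dvdn; have defk := divn_eq k n; have ltr : k %% n < n by rewrite ltn_pmod; lia.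
move: (k %/ n) (k %% n) defk ltr => q r defk ltr.
have res c : residues n k c = q + (c %% n < r).
  by rewrite defk residuesE //; lia.
rewrite !res.
have [r0|r0] := posnP r; first by rewrite r0 !ltn0; lia.
have -> : k %% n = r by rewrite defk modnMDl modn_small.
have -> : k.-1 %% n = r.-1.
  have -> : k.-1 = q * n + r.-1 by lia.
  by rewrite modnMDl modn_small //; lia.
have [lt|le] := ltnP (r + r) n.
  have -> : (k + k) %% n = r + r.
    have -> : k + k = (q + q) * n + (r + r) by lia.
    by rewrite modnMDl modn_small //; lia.
  have -> : (k.-1 + k) %% n = r.-1 + r.
    have -> : k.-1 + k = (q + q) * n + (r.-1 + r) by lia.
    by rewrite modnMDl modn_small //; lia.
  by lia.
(* If [r + r = n], the residues of [k.-1 + k] and [k + k] would be [n - 1] and 0, on different sides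
   of [r]. *)
have ne : r + r != n by apply: contraTneq nodd => <-; rewrite addnn odd_double.
have -> : (k + k) %% n = r + r - n.
  have -> : k + k = (q + q).+1 * n + (r + r - n) by lia.
  by rewrite modnMDl modn_small //; lia.
have -> : (k.-1 + k) %% n = r.-1 + r - n.
  have -> : k.-1 + k = (q + q).+1 * n + (r.-1 + r - n) by lia.
  by rewrite modnMDl modn_small //; lia.
by lia.
Qed.

(** * Beads of the inflated tile *)

Definition Lheight (n k i : nat) : nat :=
  if i < k then k * n.-1 else if i < k + k then k else 0.

Lemma young_Lheight (n k : nat) : 1 < n -> young (Lheight n k).
Proof.
move=> n1 i; rewrite /Lheight; have := leq_pmulr k (_ : 0 < n.-1).
by rewrite -ltnS prednK ?(ltnW n1) // => /(_ n1); split_ifs; lia.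
Qed.

(** Columns of equal height carry consecutive beads; the reversed indices of the first [k] columns
    start above [k], which turns [k * n.-1] into [k * n]. *)
Lemma perm_beads_Lheight (n k : nat) : 0 < n ->
  perm_eq (beads (k + k) (Lheight n k)) (block (k * n) k ++ block k k).
Proof.
move=> n0; rewrite /beads iotaD add0n map_cat.
have -> : iota k k = map (addn k) (iota 0 k) by rewrite -iotaDl addn0.
rewrite -map_comp.
apply: perm_cat; apply: perm_block => i lti; rewrite /Lheight /=.
  by rewrite lti; have : k * n = k * n.-1 + k by [rewrite -mulnSr prednK]; lia.
by split_ifs; lia.
Qed.

Lemma perm_beads0 (k : nat) :
  perm_eq (beads (k + k) (fun=> 0)) (block k k ++ block 0 k).
Proof.
rewrite /beads iotaD add0n map_cat.
have -> : iota k k = map (addn k) (iota 0 k) by rewrite -iotaDl addn0.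
rewrite -map_comp.
by apply: perm_cat; apply: perm_block => i lti /=; lia.
Qed.

(** The first block lies entirely above the second, so the order condition always holds one way and
    never the other. Both blocks have the same inner crossings, which therefore cancel modulo 2. *)
Lemma crossings_two_blocks (n c d k : nat) : d + k <= c ->
  crossings n (block c k ++ block d k) = (crossings n (block 0 k)).*2 +
    \sum_(0 <= i < k) \sum_(0 <= j < k) (d + j == c + i.+1 %[mod n]).
Proof.
move=> le; rewrite crossings_cat !(crossings_block _ c) (crossings_block _ d).
rewrite [X in _ + X]big1_seq ?addn0 => [|x /mapP[i]]; last first.
  rewrite mem_iota => lti ->; rewrite big1_seq // => y /mapP[j _ ->].
  by rewrite /crosses; lia.
rewrite addnn; congr (_ + _); rewrite /block big_map /index_iota subn0.
apply: eq_big_seq => i; rewrite mem_iota => lti; rewrite big_map.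
apply: eq_big_seq => j; rewrite mem_iota => ltj.
have -> : crosses n (c + i.+1) (d + j.+1) = (d + j.+1 == (c + i.+1).+1 %[mod n]).
  by rewrite /crosses; have -> : d + j.+1 < c + i.+1 by lia.
by rewrite addnS -(addn1 (d + j)) -(addn1 (c + i.+1)) eqn_modDr.
Qed.

Lemma odd_crossings_Lheight (n k : nat) : 1 < n -> odd n -> 0 < k ->
  odd (crossings n (beads (k + k) (Lheight n k))) =
  ~~ (n %| k) (+) odd (crossings n (beads (k + k) (fun=> 0))).
Proof.
move=> n1 nodd k0; rewrite (perm_crossings n (perm_beads_Lheight k (ltnW n1))).
rewrite (perm_crossings n (perm_beads0 k)) !crossings_two_blocks ?addn0 //; last first.
  by rewrite addnn -muln2 leq_mul2l n1 orbT.
rewrite !oddD !odd_double /= -odd_diffs //.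
(* Modulo [n] the condition is [i - j = k - 1] here, as [k * n] vanishes, and [j - i = k + 1] for
   the empty diagram. *)
have -> : \sum_(0 <= i < k) \sum_(0 <= j < k) (k + j == k * n + i.+1 %[mod n])
        = diffs n k k.-1.
  rewrite exchange_big; apply: eq_bigr => j _; apply: eq_bigr => i _.
  rewrite modnMDl eq_sym -[k in k + j](prednK k0) addSn.
  by rewrite -(addn1 (k.-1 + j)) -(addn1 i) eqn_modDr.
have -> : \sum_(0 <= i < k) \sum_(0 <= j < k) (0 + j == k + i.+1 %[mod n])
        = diffs n k k.+1.
  apply: eq_bigr => i _; apply: eq_bigr => j _.
  by rewrite add0n addSnnS.
by rewrite -addbA addbb addbF.
Qed.

Lemma sumn_block (c k : nat) : sumn (block c k) = k * c + sumn (block 0 k).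
Proof.
rewrite -{2}[k](size_iota 0) /block.
by elim: (iota 0 k) => //= i s IH; lia.
Qed.

Lemma sumn_beads_Lheight (n k : nat) : 0 < n ->
  sumn (beads (k + k) (Lheight n k)) =
  n * (k * k) + sumn (beads (k + k) (fun=> 0)).
Proof.
move=> n0; rewrite (perm_sumn (perm_beads_Lheight k n0)) (perm_sumn (perm_beads0 k)).
by rewrite !sumn_cat (sumn_block (k * n)) (sumn_block k); lia.
Qed.

(** * From tiles as sets of cells to ribbons *)

Definition cells (R : ribbon) : set cell :=
  [set c | exists x y : nat, in_ribbon R x y /\ c = (Posz x, Posz y)]%classic.

Lemma translate_eq_cells (a b : nat) (T : set cell) (R : ribbon) :
  (forall c, T c -> (0 <= c.1)%R /\ (0 <= c.2)%R) ->
  (forall x y, in_ribbon R x y -> a <= x /\ b <= y) ->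
  (forall x y : nat, T (Posz x, Posz y) <-> in_ribbon R (a + x) (b + y)) ->
  translate (Posz a, Posz b) T = cells R.
Proof.
move=> posT geR TR; apply/seteqP; split=> [_ [[x y] Tc <-]|_ [x [y [inR ->]]]] /=.
  have [/= x0 y0] := posT _ Tc.
  case: x y x0 y0 Tc => // x [] // y _ _ Tc.
  by exists (a + x), (b + y); split; first exact/TR.
have [ax bY] := geR _ _ inR.
exists (Posz (x - a), Posz (y - b)); first by apply/TR; rewrite !subnKC.
by congr pair => /=; lia.
Qed.

Lemma ribbonL_cells (n : nat) (T : set cell) (v : int * int) : 3 < n ->
  ribbonL n T ->
  (forall c, translate v T c -> (0 <= c.1)%R /\ (0 <= c.2)%R) ->
  exists2 R, Lribbons n R & translate v T = cells R.
Proof.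
case: v => va vb n4 rT pos.
have posT x y : T (x, y) -> (0 <= va + x)%R /\ (0 <= vb + y)%R.
  by move=> Txy; apply: (pos (va + x, vb + y)%R); exists (x, y).
(* [T2] and [T4] miss the corner of their bounding box, so one cell bounds [va] and another bounds
   [vb]. *)
have [va0 vb0] : (0 <= va)%R /\ (0 <= vb)%R.
  case: rT posT => -> posT.
  - by have [|] := posT 0%R 0%R; [left|]; rewrite /=; lia.
  - have [|_] := posT 1%R 0%R; first by left; rewrite /=; lia.
    by have [|] := posT 0%R (n%:Z - 2)%R; [right|lia].
  - by have [|] := posT 0%R 0%R; [left|]; rewrite /=; lia.
  - have [|+ _] := posT 0%R 1%R; first by left; rewrite /=; lia.
    by have [|] := posT (n%:Z - 2)%R 0%R; [right|lia].
case: va vb va0 vb0 {pos posT} => // a [] // b _ _.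
case: rT => ->.
- exists (Lribbon n 2 false a b); first by exists 2, false, a, b; split=> //; lia.
  apply: translate_eq_cells => [[x y] [/=|[-> ->]]|x y|x y] /=; try lia.
    by rewrite /in_ribbon /=; split_ifs; lia.
  rewrite /in_ribbon addKn /T1 /=; split=> [[|[eqx eqy]]|inR].
  + by split_ifs; lia.
  + by split_ifs; lia.
  + have [z|nz] := eqVneq x 0; [left|right; congr (_, _)];
    by move: inR; split_ifs; lia.
- exists (Lribbon n 2 true a b); first by exists 2, true, a, b; split=> //; lia.
  apply: translate_eq_cells => [[x y] [/=|[-> ->]]|x y|x y] /=; try lia.
    by rewrite /in_ribbon /=; split_ifs; lia.
  rewrite /in_ribbon addKn /T2 /=; split=> [[|[eqx eqy]]|inR].
  + by split_ifs; lia.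
  + by split_ifs; lia.
  + have [z|nz] := eqVneq x 1; [left|right; congr (_, _)];
    by move: inR; split_ifs; lia.
- exists (Lribbon n n.-1 false a b); first by exists n.-1, false, a, b; split=> //; lia.
  apply: translate_eq_cells => [[x y] [/=|[-> ->]]|x y|x y] /=; try lia.
    by rewrite /in_ribbon /=; split_ifs; lia.
  rewrite /in_ribbon addKn /T3 /=; split=> [[|[eqx eqy]]|inR].
  + by split_ifs; lia.
  + by split_ifs; lia.
  + have [z|nz] := eqVneq y 0; [left|right; congr (_, _)];
    by move: inR; split_ifs; lia.
- exists (Lribbon n n.-1 true a b); first by exists n.-1, true, a, b; split=> //; lia.
  apply: translate_eq_cells => [[x y] [/=|[-> ->]]|x y|x y] /=; try lia.
    by rewrite /in_ribbon /=; split_ifs; lia.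
  rewrite /in_ribbon addKn /T4 /=; split=> [[|[eqx eqy]]|inR].
  + by split_ifs; lia.
  + by split_ifs; lia.
  + have [z|nz] := eqVneq y 1; [left|right; congr (_, _)];
    by move: inR; split_ifs; lia.
Qed.

Lemma inflate_T1 (n k x y : nat) : 1 < n ->
  inflate k (T1 n) (Posz x, Posz y) <-> y < Lheight n k x.
Proof.
move=> n1; split=> [[[u v] T1uv [i [j [ltik ltjk [eqx eqy]]]]]|lty].
  case: T1uv => [/= [u0 /andP[v0 vn]]|[u1 v0]].
    have [v' eqv] : exists v' : nat, v = v' by exists `|v|%N; lia.
    have leM : v' * k <= (n.-1).-1 * k by rewrite leq_mul2r; lia.
    have eqn' : k * n.-1 = (n.-1).-1 * k + k by rewrite mulnC -mulSnr prednK; lia.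
    by move: eqx eqy; rewrite u0 eqv /Lheight; split_ifs; lia.
  by move: eqx eqy; rewrite u1 v0 /Lheight; split_ifs; lia.
move: lty; rewrite /Lheight; have [ltx|lex] := ltnP x k => lty.
  have k0 : 0 < k by lia.
  exists (0%R, Posz (y %/ k)).
    left=> /=; split=> //.
    have : y %/ k < n.-1 by rewrite ltn_divLR // mulnC.
    by lia.
  exists x, (y %% k); split=> //; first by rewrite ltn_mod.
  by congr (_, _); rewrite /=; have := divn_eq y k; lia.
move: lty; split_ifs => // lty.
exists (1%R, 0%R); first by right.
by exists (x - k), y; split=> //; [lia|congr (_, _); rewrite /=; lia].
Qed.

Lemma inflate_T1_nat (n k : nat) (c : cell) : inflate k (T1 n) c ->
  exists x y : nat, c = (Posz x, Posz y).
Proof.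
case=> -[u v] T1uv [i [j [_ _ ->]]].
have [u' [v' [/= -> ->]]] : exists u' v' : nat, u = u' /\ v = v'.
  exists `|u|%N, `|v|%N; case: T1uv => [/=|[-> ->]]; lia.
by exists (k * u' + i), (k * v' + j); congr (_, _); lia.
Qed.

Lemma replicating_ribbon_tiling (n k : nat) : 3 < n -> skewedL_replicating n k ->
  exists2 Q, ribbon_tiling (Lheight n k) Q & forall R, Q R -> Lribbons n R.
Proof.
move=> n4 [P [PT [covP trivP _]]].
have n1 : 1 < n by lia.
have sub A c : P A -> A c -> inflate k (T1 n) c.
  by move=> PA Ac; rewrite -covP; exists A.
exists (fun R => Lribbons n R /\ P (cells R)); last by move=> R [].
split=> [R [[w [l [a [b [w1 ->]]]]] _]|R x y [_ PR] inR|x y|R S x y [_ PR] [_ PS] inR inS].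
- by apply: Lribbon_wf; lia.
- by apply/inflate_T1/(sub _ _ PR) => //; exists x, y.
- move/(inflate_T1 _ _ _ n1); rewrite -covP => -[A PA Axy].
  have [T rT [v eqA]] := PT A PA.
  have [c|R LR eqR] := ribbonL_cells n4 rT (v := v).
    by rewrite -eqA => /(sub _ _ PA)/inflate_T1_nat[x' [y' ->]].
  move: Axy; rewrite eqA eqR => -[x' [y' [inR [-> ->]]]].
  by exists R => //; split=> //; rewrite -eqR -eqA.
- have eqRS : cells R = cells S.
    apply: trivP => //; exists (Posz x, Posz y); split; first by exists x, y.
    by exists x, y.
  move=> x' y'; apply/idP/idP => in'.
    have : cells R (Posz x', Posz y') by exists x', y'.
    by rewrite eqRS => -[? [? [? [-> ->]]]].
  have : cells S (Posz x', Posz y') by exists x', y'.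
  by rewrite -eqRS => -[? [? [? [-> ->]]]].
Qed.

Theorem proposition6 (n k : nat) (hn : 5 <= n) (n_odd : odd n) (hk : 1 <= k) :
  (odd k -> n %| k -> ~ skewedL_replicating n k) /\
  (~~ odd k -> ~~ (n %| k) -> ~ skewedL_replicating n k).
Proof.
suff parity : skewedL_replicating n k -> odd k = ~~ (n %| k).
  by split=> [ok dk|ok dk] /parity; rewrite dk; [rewrite ok|move/negbTE: ok => ->].
have n1 : 1 < n by lia.
move=> /replicating_ribbon_tiling-/(_ (ltnW hn))[Q tQ LQ].
have hM : Lheight n k (k + k) = 0 by rewrite /Lheight; split_ifs; lia.
have [t] := tiling_parity (young_Lheight k n1) hM tQ LQ.
(* Comparing the two formulas for the bead sum gives [t = k * k], which has the parity of [k]. *)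
rewrite sumn_beads_Lheight ?(ltnW n1) // => /addIn/eqP.
rewrite eqn_pmul2l ?(ltnW n1) // => /eqP <-.
by rewrite odd_crossings_Lheight // => /addIb; rewrite oddM andbb => ->.
Qed.
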